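(* Let $n\ge 1$ and let $a_1,\ldots,a_n:\mathbb{Z}_+\to\mathbb{Z}$ be functions in $\mathrm{EQP}$, each eventually positive and each of degree at most $1$. Then the function $t\mapsto F\big(a_1(t),\ldots,a_n(t)\big)$ (defined for all sufficiently large $t$) is in $\mathrm{EQP}$ and has degree at most $2$.
   Context: For positive integers $a_1,\ldots,a_n$, let $\langle a_1,\ldots,a_n\rangle=\{\sum_{i=1}^n p_ia_i : p_i\in\mathbb{Z}_{\ge 0}\}$. The Frobenius number $F(a_1,\ldots,a_n)$ is the largest integer in the group $\mathbb{Z}a_1+\cdots+\mathbb{Z}a_n$ that is not in $\langle a_1,\ldots,a_n\rangle$; equivalently, if $d=\gcd(a_1,\ldots,a_n)$, then $F(a_1,\ldots,a_n)=d\,F(a_1/d,\ldots,a_n/d)$, where for relatively prime arguments $F$ is the largest integer not in the semigroup. A function $f:\mathbb{Z}_+\to\mathbb{Z}$ is a quasi-polynomial if there exist $m\in\mathbb{Z}_+$ and polynomials $f_0,\ldots,f_{m-1}\in\mathbb{Q}[t]$ with $f(t)=f_{t \bmod m}(t)$ for all $t\in\mathbb{Z}_+$ ($m$ is a period, the $f_j$ are components). A property holds eventually if it holds for all sufficiently large $t$. $f\in\mathrm{EQP}$ means $f$ eventually agrees with a quasi-polynomial; the degree of $f\in\mathrm{EQP}$ is the maximum degree of the components of that quasi-polynomial. *)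

(* Defs.v *)
From mathcomp Require Import all_boot all_order all_algebra.
From mathcomp Require Import mathcomp_extra boolp classical_sets filter.

Set Implicit Arguments.
Unset Strict Implicit.
Unset Printing Implicit Defensive.

Import Order.TTheory GRing.Theory Num.Theory.
Local Open Scope classical_set_scope.
Local Open Scope ring_scope.

(* A function on the positive integers is given by f : nat -> int, whose value
   at 0 is irrelevant. *)

(* The period is the length of the list c, so that c`_0, ..., c`_(m-1) are the
   components f_0, ..., f_(m-1). *)
Definition has_components (f : nat -> int) (c : seq {poly rat}) : Prop :=
  (0 < size c)%N /\
  forall t : nat, (0 < t)%N -> (f t)%:~R = (c`_(t %% size c)%N).[t%:R].

Definition quasi_polynomial (f : nat -> int) : Prop :=
  exists c : seq {poly rat}, has_components f c.

Definition EQP (f : nat -> int) : Prop :=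
  exists2 g : nat -> int,
    quasi_polynomial g & \forall t \near eventually, f t = g t.

Definition is_EQP_degree (f : nat -> int) (d : nat) : Prop :=
  exists (g : nat -> int) (c : seq {poly rat}),
    [/\ has_components g c,
        \forall t \near eventually, f t = g t
      & d = (\max_(p <- c) (size p).-1)%N].

(* The zero polynomial counts as having degree 0.  When EQP f holds, exactly one
   d satisfies is_EQP_degree f d: the set of components does not depend on the
   period, nor on the quasi-polynomial g.  Outside EQP the value is the default
   0. *)
Definition EQP_degree (f : nat -> int) : nat :=
  xget 0%N [set d | is_EQP_degree f d].

Definition in_span (n : nat) (a : 'I_n -> int) (x : int) : Prop :=
  exists p : 'I_n -> int, x = \sum_(i < n) p i * a i.

Definition in_semigroup (n : nat) (a : 'I_n -> int) (x : int) : Prop :=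
  exists p : 'I_n -> nat, x = \sum_(i < n) (p i)%:Z * a i.

(* The largest element may be negative: it is -1 for the single generator 1. *)
Definition is_frobenius (n : nat) (a : 'I_n -> int) (x : int) : Prop :=
  [/\ in_span a x, ~ in_semigroup a x
    & forall y : int, in_span a y -> ~ in_semigroup a y -> y <= x].

(* Meaningful only when a largest element exists, which is the case as soon as
   0 < n and every a i is positive; the default value is 0. *)
Definition frobenius (n : nat) (a : 'I_n -> int) : int :=
  xget 0 [set x | is_frobenius a x].

(* Main.v *)
(* Restricting t to an arithmetic progression, a_i = al_i s + be_i. Write
   x = x1 s + x0 with 0 <= x0 < s. If x lies in the semigroup (or in the group)
   generated by the a_i, it does so with all coefficients but the one at i0
   below a_{i0}; when |x| is O(a_{i0} s), as is the case for the Frobenius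
   number, all coefficients are then O(s), hence
   (x1 - k, x0 + k s) = sum_i p_i (al_i, be_i) for some k bounded independently
   of s. So both digits of the Frobenius number are defined by formulas of
   Presburger arithmetic in s. A Presburger-definable function is eventually
   quasi-linear, and x1 s + x0 is therefore a quasi-polynomial of degree at
   most 2. *)

Require Import Defs.
From mathcomp Require Import all_boot all_order all_algebra.
From mathcomp Require Import mathcomp_extra boolp classical_sets filter.
From mathcomp Require Import zify ring.

Set Implicit Arguments.
Unset Strict Implicit.
Unset Printing Implicit Defensive.

Import Order.TTheory GRing.Theory Num.Theory.
Local Open Scope classical_set_scope.
Local Open Scope ring_scope.

(** * Presburger formulas and quantifier elimination *)

(* Formulas are represented semantically: a context is a type [V] of valuations
   with a class of functions on it standing for the affine forms. Adding a
   variable replaces [V] by [V * int] and the class by [extend A]. *)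
Record affine_class (V : Type) (A : (V -> int) -> Prop) : Prop := AffineClass {
  affC : forall c, A (fun=> c);
  affD : forall f g, A f -> A g -> A (fun v => f v + g v);
  affM : forall c f, A f -> A (fun v => c * f v) }.

Definition extend V (A : (V -> int) -> Prop) (g : V * int -> int) : Prop :=
  exists f c, A f /\ forall w, g w = f w.1 + c * w.2.

Inductive presburger V (A : (V -> int) -> Prop) : (V -> Prop) -> Prop :=
| PbGe0 f of A f : presburger A (fun v => 0 <= f v)
| PbDvd (m : nat) f of (0 < m)%N & A f : presburger A (fun v => (m %| f v)%Z)
| PbAnd P Q of presburger A P & presburger A Q :
    presburger A (fun v => P v /\ Q v)
| PbNot P of presburger A P : presburger A (fun v => ~ P v).

(* Finite unions of graphs of functions [f / c]. *)
Inductive thin V (A : (V -> int) -> Prop) : (V * int -> Prop) -> Prop :=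
| Thin0 : thin A (fun=> False)
| ThinGraph c f of 0 < c & A f : thin A (fun w => c * w.2 = f w.1)
| ThinU J K of thin A J & thin A K : thin A (fun w => J w \/ K w).

Lemma eq_presburger V (A : (V -> int) -> Prop) (P Q : V -> Prop) :
  (forall v, P v <-> Q v) -> presburger A P -> presburger A Q.
Proof. by move=> PQ; have -> : P = Q by apply/funext => v; apply/propext. Qed.

Section Presburger.
Variables (V : Type) (A : (V -> int) -> Prop).
Hypothesis Aaff : affine_class A.

Lemma eq_aff f g : f =1 g -> A f -> A g.
Proof. by move/funext->. Qed.

Lemma affB f g : A f -> A g -> A (fun v => f v - g v).
Proof.
move=> Af Ag; apply: (@eq_aff (fun v => f v + (-1) * g v)).
  by move=> v; rewrite mulN1r.
exact: (affD Aaff Af (affM Aaff _ Ag)).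
Qed.

Lemma extend_affine_class : affine_class (extend A).
Proof.
split.
- by move=> c; exists (fun=> c), 0; split=> [|w]; [exact: affC|rewrite mul0r addr0].
- move=> f g [f' [c [Af fE]]] [g' [d [Ag gE]]].
  exists (fun v => f' v + g' v), (c + d); split; first exact: affD.
  by move=> w; rewrite fE gE mulrDl addrACA.
- move=> c f [f' [d [Af fE]]]; exists (fun v => c * f' v), (c * d).
  by split=> [|w]; [exact: affM|rewrite fE mulrDr mulrA].
Qed.

Lemma extend_fst f : A f -> extend A (fun w => f w.1).
Proof. by move=> Af; exists f, 0; split=> // w; rewrite mul0r addr0. Qed.

Lemma extend_snd : extend A (fun w => w.2).
Proof.
by exists (fun=> 0), 1; split=> [|w]; [exact: affC|rewrite add0r mul1r].
Qed.

Lemma pb_True : presburger A (fun=> True).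
Proof.
by apply: eq_presburger (PbGe0 (affC Aaff 0)) => v; rewrite lexx.
Qed.

Lemma pb_False : presburger A (fun=> False).
Proof. by apply: eq_presburger (PbNot pb_True) => v; split=> // H; apply: H. Qed.

Lemma pb_or P Q : presburger A P -> presburger A Q ->
  presburger A (fun v => P v \/ Q v).
Proof.
move=> pP pQ; apply: eq_presburger (PbNot (PbAnd (PbNot pP) (PbNot pQ))) => v.
by rewrite not_andE !notE.
Qed.

Lemma pb_imp P Q : presburger A P -> presburger A Q ->
  presburger A (fun v => P v -> Q v).
Proof.
move=> pP pQ; apply: eq_presburger (pb_or (PbNot pP) pQ) => v.
by split=> [[]//|PQ]; have [/PQ|] := pselect (P v); [right|left].
Qed.

Lemma pb_le f g : A f -> A g -> presburger A (fun v => f v <= g v).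
Proof.
by move=> Af Ag; apply: eq_presburger (PbGe0 (affB Ag Af)) => v; rewrite subr_ge0.
Qed.

Lemma pb_lt f g : A f -> A g -> presburger A (fun v => f v < g v).
Proof.
by move=> Af Ag; apply: eq_presburger (PbNot (pb_le Ag Af)) => v; lia.
Qed.

Lemma pb_eq f g : A f -> A g -> presburger A (fun v => f v = g v).
Proof.
move=> Af Ag; apply: eq_presburger (PbAnd (pb_le Af Ag) (pb_le Ag Af)) => v.
by lia.
Qed.

Lemma pb_bex (T : eqType) (s : seq T) (P : T -> V -> Prop) :
  (forall k, presburger A (P k)) ->
  presburger A (fun v => exists2 k, k \in s & P k v).
Proof.
move=> pP; elim: s => [|k s IHs].
  by apply: eq_presburger pb_False => v; split=> // -[].
apply: eq_presburger (pb_or (pP k) IHs) => v; split.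
  by case=> [Pk|[l ls Pl]]; [exists k|exists l]; rewrite // inE ?eqxx// ls orbT.
by case=> l; rewrite inE => /orP[/eqP->|ls] Pl; [left|right; exists l].
Qed.

(** Multiplying an atom through by [c > 0] replaces [c * x] by [f v] and removes [x]; a modulus [m]
    becomes [c * m]. Such an [x] is unique, so conjunction and negation go through, provided the
    divisibility of [f v] by [c] is kept as a conjunct. *)
Lemma pb_subst P c f : presburger (extend A) P -> 0 < c -> A f ->
  presburger A (fun v => exists2 x, c * x = f v & P (v, x)).
Proof.
move=> pP c0 Af.
have dvdE v : (`|c|%N %| f v)%Z <-> exists x, c * x = f v.
  rewrite gtz0_abs//; split=> [/dvdzP[q ->]|[x <-]]; last exact: dvdz_mulr.
  by exists q; rewrite mulrC.
have pc : presburger A (fun v => exists x, c * x = f v).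
  by apply: (eq_presburger dvdE); apply: PbDvd; rewrite ?absz_gt0 ?gt_eqF.
have atom (R : V -> Prop) (S : V * int -> Prop) : presburger A R ->
    (forall v x, c * x = f v -> R v <-> S (v, x)) ->
    presburger A (fun v => exists2 x, c * x = f v & S (v, x)).
  move=> pR RS; apply: eq_presburger (PbAnd pc pR) => v; split.
    by case=> -[x cx] /(RS _ _ cx); exists x.
  by case=> x cx /(RS _ _ cx) Rv; split=> //; exists x.
elim: P / pP => [g [g' [d [Ag gE]]]|m g m0 [g' [d [Ag gE]]]|P Q _ IHP _ IHQ|P _ IHP].
- have pR := PbGe0 (affD Aaff (affM Aaff c Ag) (affM Aaff d Af)).
  apply: (atom _ (fun w => 0 <= g w) pR) => v x cx; rewrite gE/= -cx mulrCA -mulrDr.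
  by rewrite pmulr_rge0.
- have cm0 : (0 < `|c| * m)%N by rewrite muln_gt0 absz_gt0 gt_eqF.
  have pR := PbDvd cm0 (affD Aaff (affM Aaff c Ag) (affM Aaff d Af)).
  apply: (atom _ (fun w => (m %| g w)%Z) pR) => v x cx; rewrite gE/= -cx mulrCA -mulrDr.
  by rewrite PoszM gtz0_abs// dvdz_mul2l ?lt0r_neq0.
- apply: eq_presburger (PbAnd IHP IHQ) => v; split.
    case=> -[x cx Px] [y cy Qy]; exists x => //.
    by split=> //; have <- : y = x by apply: (mulfI (lt0r_neq0 c0)); rewrite cx cy.
  by case=> x cx [Px Qx]; split; exists x.
- apply: (atom _ (fun w => ~ P w) (PbNot IHP)) => v x cx; split=> nP.
    by move=> Px; apply: nP; exists x.
  case=> y cy; suff <- : x = y by [].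
  by apply: (mulfI (lt0r_neq0 c0)); rewrite cx cy.
Qed.

Lemma pb_thin J P : thin A J -> presburger (extend A) P ->
  presburger A (fun v => exists2 x, J (v, x) & P (v, x)).
Proof.
move=> tJ pP; elim: J / tJ => [|c f c0 Af|J K _ IHJ _ IHK].
- by apply: eq_presburger pb_False => v; split=> // -[].
- exact: (pb_subst pP c0 Af).
- apply: eq_presburger (pb_or IHJ IHK) => v; split.
    by case=> -[x Jx Px]; exists x; [left| |right|].
  by case=> x [Jx|Jx] Px; [left|right]; exists x.
Qed.

Lemma thin_strip c f (b : nat) : 0 < c -> A f ->
  thin A (fun w => f w.1 <= c * w.2 < f w.1 + b%:Z).
Proof.
move=> c0 Af; elim: b => [|b IHb].
  have -> : (fun w : V * int => is_true (f w.1 <= c * w.2 < f w.1 + 0%N%:Z)) = (fun=> False).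
    by apply/funext => w; apply/propext; split=> //; lia.
  exact: Thin0.
have := ThinU IHb (ThinGraph c0 (affD Aaff Af (affC Aaff b%:Z))).
by congr (thin _ _); apply/funext => w; apply/propext; lia.
Qed.

(* For fixed [v], the truth value of [P] changes between [x - M] and [x] only at
   the boundary points of finitely many inequalities. *)
Lemma presburger_jump P : presburger (extend A) P ->
  exists2 M0, (0 < M0)%N & forall M, (0 < M)%N -> (M0 %| M)%N ->
  exists2 J, thin A J &
    forall v x, ~ J (v, x) -> P (v, x) <-> P (v, x - M%:Z).
Proof.
elim: P / => [g [f [c [Af gE]]]|m g m0 [f [c [Af gE]]]|P Q _ [M1 M10 IHP] _ [M2 M20 IHQ]|P _ [M0 M00 IHP]].
- exists 1%N => // M M0 _; have [c0|c0|c0] := ltgtP c 0.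
  + have Nc0 : 0 < - c by rewrite oppr_gt0.
    (* The inequality fails once [- c * x] reaches [f v + 1]. It can differ at [x] and [x - M] only
       within [|c| * M] values from there on. *)
    have := thin_strip (`|c| * M)%N Nc0 (affD Aaff Af (affC Aaff 1)).
    by eexists; first eassumption; move=> v x /=; rewrite !gE/=; nia.
  + have Af' := affB (affC Aaff 0) Af.
    have := thin_strip (`|c| * M)%N c0 Af'.
    by eexists; first eassumption; move=> v x /=; rewrite !gE/=; nia.
  + by exists (fun=> False); [exact: Thin0|move=> v x _; rewrite !gE/= c0 !mul0r].
- exists m => // M M0 mM; exists (fun=> False); first exact: Thin0.
  move=> v x _; rewrite !gE/= mulrBr addrA.
  have d : (m %| c * M%:Z)%Z by rewrite dvdz_mull.
  split=> H; first by rewrite rpredB.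
  by rewrite -[X in (_ %| X)%Z](subrK (c * M%:Z)) rpredD.
- exists (M1 * M2)%N => [|M M0 dM]; first by rewrite muln_gt0 M10.
  have [J tJ PJ] := IHP M M0 (dvdn_trans (dvdn_mulr _ (dvdnn _)) dM).
  have [K tK QK] := IHQ M M0 (dvdn_trans (dvdn_mull _ (dvdnn _)) dM).
  exists (fun w => J w \/ K w); first exact: ThinU.
  by move=> v x /not_orP[/PJ PE /QK QE]; rewrite PE QE.
- exists M0 => // M MP dM; have [J tJ PJ] := IHP M MP dM.
  by exists J => // v x /PJ PE; rewrite PE.
Qed.

(** Far down the progression an inequality is settled by the sign of [c], or does not involve [x] if
    [c = 0]; a divisibility is constant along it because its modulus divides [M]. The threshold [N]
    depends on [v], but [Q] does not. *)
Lemma presburger_limit P : presburger (extend A) P ->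
  exists2 M0, (0 < M0)%N & forall M j, (0 < M)%N -> (M0 %| M)%N ->
  exists Q, presburger A Q /\ forall v, exists N : nat,
    forall i : nat, (N <= i)%N -> P (v, j - i%:Z * M%:Z) <-> Q v.
Proof.
elim: P / => [g [f [c [Af gE]]]|m g m0 [f [c [Af gE]]]|P Q _ [M1 M10 IHP] _ [M2 M20 IHQ]|P _ [M0 M00 IHP]].
- exists 1%N => // M j M0 _; have [c0|c0|c0] := ltgtP c 0.
  + exists (fun=> True); split; first exact: pb_True.
    move=> v; exists (`|(f v + c * j)%R|)%N => i Ni; rewrite gE/= mulrBr; split=> // _.
    have : i%:Z * 1 <= - c * (i%:Z * M%:Z).
      by rewrite mulrCA ler_wpM2l//; nia.
    by lia.
  + exists (fun=> False); split; first exact: pb_False.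
    move=> v; exists (`|(f v + c * j)%R|).+1%N => i Ni; rewrite gE/= mulrBr; split=> //.
    have : i%:Z * 1 <= c * (i%:Z * M%:Z).
      by rewrite mulrCA ler_wpM2l//; nia.
    by lia.
  + exists (fun v => 0 <= f v); split; first exact: PbGe0.
    by move=> v; exists 0%N => i _; rewrite gE/= c0 mul0r addr0.
- exists m => // M j M0 mM; exists (fun v => (m %| f v + c * j)%Z); split.
    by apply: PbDvd => //; apply: affD => //; exact: affC.
  move=> v; exists 0%N => i _; rewrite gE/= mulrBr addrA.
  have d : (m %| c * (i%:Z * M%:Z))%Z by rewrite mulrA dvdz_mull.
  split=> H; last by rewrite rpredB.
  by rewrite -[X in (_ %| X)%Z](subrK (c * (i%:Z * M%:Z))) rpredD.
- exists (M1 * M2)%N => [|M j M0 dM]; first by rewrite muln_gt0 M10.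
  have [P' [pP PP]] := IHP M j M0 (dvdn_trans (dvdn_mulr _ (dvdnn _)) dM).
  have [Q' [pQ QQ]] := IHQ M j M0 (dvdn_trans (dvdn_mull _ (dvdnn _)) dM).
  exists (fun v => P' v /\ Q' v); split=> [|v]; first exact: PbAnd.
  have [[N1 PN] [N2 QN]] := (PP v, QQ v).
  exists (maxn N1 N2) => i; rewrite geq_max => /andP[/PN PE /QN QE].
  by rewrite PE QE.
- exists M0 => // M j MP dM; have [Q [pQ PQ]] := IHP M j MP dM.
  exists (fun v => ~ Q v); split=> [|v]; first exact: PbNot.
  by have [N PN] := PQ v; exists N => i /PN ->.
Qed.

(* Cooper's quantifier elimination: descending from a witness in steps of [M],
   either one meets a boundary point or [P] holds down to -oo. *)
Lemma pb_exists P : presburger (extend A) P ->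
  presburger A (fun v => exists x, P (v, x)).
Proof.
move=> pP; have [M1 M10 jump] := presburger_jump pP.
have [M2 M20 limit] := presburger_limit pP.
pose M := (M1 * M2)%N; have M0 : (0 < M)%N by rewrite muln_gt0 M10.
have [J tJ PJ] := jump M M0 (dvdn_mulr _ (dvdnn _)).
have [Q PQ] := choice (fun j => limit M j M0 (dvdn_mull _ (dvdnn _))).
have pQ : presburger A (fun v => exists2 j : nat, j \in iota 0 M & Q j%:Z v).
  by apply: pb_bex => j; case: (PQ j%:Z).
apply: eq_presburger (pb_or (pb_thin tJ pP) pQ) => v; split.
  case=> [[x _ Px]|[j _ Qj]]; first by exists x.
  have [_ /(_ v)[N /(_ N (leqnn _)) PE]] := PQ j%:Z.
  by eexists; apply/PE.
case=> x Px; apply: contrapT => /not_orP[nJ nQ].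
have down (i : nat) : P (v, x - i%:Z * M%:Z).
  elim: i => [|i IHi]; first by rewrite mul0r subr0.
  have -> : x - i.+1%:Z * M%:Z = x - i%:Z * M%:Z - M%:Z by lia.
  by rewrite -PJ// => Jx; apply: nJ; exists (x - i%:Z * M%:Z).
have xE := divz_eq x M; set q := (x %/ M)%Z in xE; set j := (x %% M)%Z in xE.
have j0 : 0 <= j by apply: modz_ge0; lia.
have jM : j < M%:Z by apply: ltz_pmod; lia.
apply: nQ; exists (absz j); first by rewrite mem_iota; clear -j0 jM; lia.
have [_ /(_ v)[N PN]] := PQ (absz j)%:Z.
(* Since [x = q * M + j], this point of the progression from [j] is [x - (N + |q| + q) * M]. Adding
   [|q|] keeps that index nonnegative, so [down] reaches the point. *)
apply/(PN (N + absz q)%N); first exact: leq_addr.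
suff -> : (absz j)%:Z - (N + absz q)%N%:Z * M%:Z =
    x - (absz (N%:Z + (absz q)%:Z + q))%:Z * M%:Z by exact: down.
have E : (absz (N%:Z + (absz q)%:Z + q))%:Z = N%:Z + (absz q)%:Z + q.
  by clear; lia.
by rewrite E xE gez0_abs// PoszD; ring.
Qed.

Lemma pb_forall P : presburger (extend A) P ->
  presburger A (fun v => forall x, P (v, x)).
Proof.
move=> pP; apply: eq_presburger (PbNot (pb_exists (PbNot pP))) => v.
by split=> [H x|H [x []//]]; apply: contrapT => nP; apply: H; exists x.
Qed.

End Presburger.

(** * Eventual periodicity of formulas in one variable *)

Definition affine1 (f : int -> int) : Prop :=
  exists c d, forall s, f s = c * s + d.

Lemma affine1_class : affine_class affine1.
Proof.
split.
- by move=> c; exists 0, c => s; rewrite mul0r add0r.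
- move=> f g [c [d fE]] [c' [d' gE]]; exists (c + c'), (d + d') => s.
  by rewrite fE gE; ring.
- move=> k f [c [d fE]]; exists (k * c), (k * d) => s.
  by rewrite fE; ring.
Qed.

(** Once [s] exceeds [|d|], the sign of [c * s + d] is that of [c], unless [c = 0]; a divisibility
    depends only on the residue of [s]. *)
Lemma presburger_periodic P : presburger affine1 P ->
  exists2 M0, (0 < M0)%N & forall M, (0 < M)%N -> (M0 %| M)%N ->
  exists N : nat, forall s r : int, N%:Z <= s -> N%:Z <= r ->
    (M %| s - r)%Z -> P s <-> P r.
Proof.
elim: P / => [f [c [d fE]]|m f m0 [c [d fE]]|P Q _ [M1 M10 IHP] _ [M2 M20 IHQ]|P _ [M0 M00 IHP]].
- exists 1%N => // M _ _; exists (absz d).+1 => s r Ns Nr _; rewrite !fE.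
  have [c0|c0|->] := ltgtP c 0; last by rewrite !mul0r.
  + by split; nia.
  + by split; nia.
- exists m => // M _ mM; exists 0%N => s r _ _ Msr; rewrite !fE.
  have d1 : (m %| (c * s + d) - (c * r + d))%Z.
    have -> : (c * s + d) - (c * r + d) = c * (s - r) by ring.
    by rewrite dvdz_mull// (dvdz_trans _ Msr).
  split=> H; first by rewrite -(subKr (c * s + d) (c * r + d)) rpredB.
  by rewrite -[X in (_ %| X)%Z](subrK (c * r + d)) rpredD.
- exists (M1 * M2)%N => [|M M0 dM]; first by rewrite muln_gt0 M10.
  have [N1 PN] := IHP M M0 (dvdn_trans (dvdn_mulr _ (dvdnn _)) dM).
  have [N2 QN] := IHQ M M0 (dvdn_trans (dvdn_mull _ (dvdnn _)) dM).
  by exists (maxn N1 N2) => s r Ns Nr Msr; rewrite (PN s r) ?(QN s r)//; lia.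
- exists M0 => // M M1 dM; have [N PN] := IHP M M1 dM.
  by exists N => s r Ns Nr Msr; rewrite (PN s r).
Qed.

(** * Eventual quasi-polynomials and Presburger-definable functions *)

(** Unlike [EQP], this carries the degree bound and does not ask that the polynomials take integer
    values below [N]. *)
Definition evqp (d : nat) (h : nat -> int) : Prop :=
  exists M N (p : nat -> {poly rat}),
  [/\ (0 < M)%N, forall j, (size (p j) <= d.+1)%N &
      forall t, (N <= t)%N -> (h t)%:~R = (p (t %% M)%N).[t%:R]].

Lemma evqp_multiple d h M0 N0 (p0 : nat -> {poly rat}) M :
  (forall j, (size (p0 j) <= d.+1)%N) ->
  (forall t, (N0 <= t)%N -> (h t)%:~R = (p0 (t %% M0)%N).[t%:R]) ->
  (M0 %| M)%N ->
  exists p : nat -> {poly rat}, (forall j, (size (p j) <= d.+1)%N) /\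
    forall t, (N0 <= t)%N -> (h t)%:~R = (p (t %% M)%N).[t%:R].
Proof.
move=> sp hp dM; exists (fun j => p0 (j %% M0)%N); split=> [j|t Nt]; first exact: sp.
by rewrite modn_dvdm// hp.
Qed.

Lemma eq_evqp d h h' N : (forall t, (N <= t)%N -> h t = h' t) ->
  evqp d h -> evqp d h'.
Proof.
move=> hh' [M [N' [p [M0 sp hp]]]]; exists M, (maxn N N'), p; split=> // t.
by rewrite geq_max => /andP[Nt /hp <-]; rewrite hh'.
Qed.

Lemma evqp_combine d1 d2 d (h1 h2 h : nat -> int)
    (op : {poly rat} -> {poly rat} -> {poly rat}) :
  (forall p q : {poly rat}, (size p <= d1.+1)%N -> (size q <= d2.+1)%N -> (size (op p q) <= d.+1)%N) ->
  (forall t p q, (h1 t)%:~R = p.[t%:R] -> (h2 t)%:~R = q.[t%:R] ->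
     (h t)%:~R = (op p q).[t%:R]) ->
  evqp d1 h1 -> evqp d2 h2 -> evqp d h.
Proof.
move=> sop hop [M1 [N1 [p1 [M10 sp1 hp1]]]] [M2 [N2 [p2 [M20 sp2 hp2]]]].
have [q1 [sq1 hq1]] := evqp_multiple sp1 hp1 (dvdn_mulr M2 (dvdnn _)).
have [q2 [sq2 hq2]] := evqp_multiple sp2 hp2 (dvdn_mull M1 (dvdnn _)).
exists (M1 * M2)%N, (maxn N1 N2), (fun j => op (q1 j) (q2 j)); split.
- by rewrite muln_gt0 M10.
- by move=> j; apply: sop.
- by move=> t; rewrite geq_max => /andP[/hq1 E1 /hq2 E2]; apply: hop.
Qed.

(* Which of the finitely many branches of [J] contains the graph of [g] is
   eventually periodic. *)
Lemma thin_evqp J P g S0 : thin affine1 J -> presburger (extend affine1) P ->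
  (forall s y, S0%:Z <= s -> P (s, y) <-> y = g s) ->
  exists2 M0, (0 < M0)%N & forall M, (0 < M)%N -> (M0 %| M)%N ->
  exists N (p : nat -> {poly rat}), (forall j, (size (p j) <= 2)%N) /\
    forall t : nat, (N <= t)%N -> J (t%:Z, g t%:Z) ->
      (g t)%:~R = (p (t %% M)%N).[t%:R].
Proof.
move=> tJ pP Pg; elim: J / tJ => [|c f c0 [a [b fE]]|J K tJ [M1 M10 IHJ] tK [M2 M20 IHK]].
- exists 1%N => // M _ _; exists 0%N, (fun=> 0); split=> // j.
  by rewrite size_poly0.
- exists 1%N => // M _ _; exists 0%N, (fun=> (a%:~R / c%:~R) *: 'X + (b%:~R / c%:~R)%:P).
  split=> [j|t _ /= E].
    rewrite (leq_trans (size_polyD _ _))// geq_max (leq_trans (size_scale_leq _ _)) ?size_polyX//.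
    by rewrite (leq_trans (size_polyC_leq1 _)).
  rewrite !hornerE; have cn0 : (c%:~R : rat) != 0 by rewrite intr_eq0 lt0r_neq0.
  apply: (mulfI cn0); rewrite -intrM E fE mulrDr mulrA !mulrA.
  by rewrite intrD intrM; field.
(* [P] defines the graph of [g], so [J (s, g s)] is a Presburger condition on [s] alone and is
   eventually periodic. *)
- have [M3 M30 perJ] := presburger_periodic (pb_thin affine1_class tJ pP).
  exists (M1 * M2 * M3)%N => [|M M0 dM]; first by rewrite !muln_gt0 M10 M20.
  have [N1 [p1 [sp1 hp1]]] := IHJ M M0 (dvdn_trans (dvdn_mulr _ (dvdn_mulr _ (dvdnn _))) dM).
  have [N2 [p2 [sp2 hp2]]] := IHK M M0 (dvdn_trans (dvdn_mulr _ (dvdn_mull _ (dvdnn _))) dM).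
  have [N3 perM] := perJ M M0 (dvdn_trans (dvdn_mull _ (dvdnn _)) dM).
  pose N := maxn (maxn N1 N2) (maxn N3 S0).
  have JE s : S0%:Z <= s -> (exists2 x, J (s, x) & P (s, x)) <-> J (s, g s).
    move=> Ss; split=> [[x Jx /(Pg _ _ Ss) <-]//|Js].
    by exists (g s) => //; apply/Pg.
  (* One large [t] of the class [j] on the branch [J] puts all of them there, by [perM]; if there is
     none, the branch is [K]. *)
  pose b j := `[< exists t : nat, [/\ (N <= t)%N, (t %% M)%N = j & J (t%:Z, g t%:Z)] >].
  exists N, (fun j => if b j then p1 j else p2 j); split=> [j|t Nt JK].
    by case: ifP.
  case: ifPn => [/asboolP[t' [Nt' tt' Jt']]|nb].
    apply: hp1; first by lia.
    apply/JE; first by lia.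
    apply/(perM t' t); [lia|lia| |apply/JE => //; lia].
    by rewrite -eqz_mod_dvd !modz_nat tt' eqxx.
  case: JK => [Jt|Kt]; last by apply: hp2 => //; lia.
  by case/asboolP: nb; exists t.
Qed.

(** [P] holds at [g s] and fails at [g s - M1], so [(s, g s)] is a jump of [P] and must lie on one
    of the finitely many graphs in [J]. *)
Lemma presburger_fun_evqp P (g : int -> int) S0 :
  presburger (extend affine1) P ->
  (forall s y, S0%:Z <= s -> P (s, y) <-> y = g s) ->
  evqp 1 (fun t : nat => g t).
Proof.
move=> pP Pg; have [M1 M10 jump] := presburger_jump affine1_class pP.
have [J tJ PJ] := jump M1 M10 (dvdnn _).
have [M M0 /(_ M M0 (dvdnn _))[N [p [sp hp]]]] := thin_evqp tJ pP Pg.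
exists M, (maxn N S0), p; split=> // t Nt; apply: hp; first by lia.
by apply: contrapT => /PJ; rewrite !Pg; lia.
Qed.

(** On the class of [r] the polynomials are composed with [(X - r) / m], which keeps the degree
    bound. The residue of [t] modulo [m * M] determines both [t %% m] and the residue of [t %/ m]
    modulo [M]. *)
Lemma evqp_glue d h m : (0 < m)%N ->
  (forall r, evqp d (fun s => h (m * s + r)%N)) -> evqp d h.
Proof.
move=> m0 /choice[Mr] /choice[Nr] /choice[p pP].
pose M := (\prod_(r < m) Mr r)%N.
have M0 : (0 < M)%N by apply: prodn_gt0 => r; case: (pP r).
have /choice[q qP] r : exists q : nat -> {poly rat},
   (r < m)%N -> (forall j, (size (q j) <= d.+1)%N) /\
    forall t, (Nr r <= t)%N -> (h (m * t + r)%N)%:~R = (q (t %% M)%N).[t%:R].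
  have [rm|] := boolP (r < m)%N; last by exists (fun=> 0).
  have [_ sp hp] := pP r.
  have dM : (Mr r %| M)%N by rewrite /M (bigD1 (Ordinal rm))//= dvdn_mulr.
  by have [q [sq hq]] := evqp_multiple sp hp dM; exists q.
pose x r : {poly rat} := m%:R^-1 *: ('X - r%:R%:P).
exists (m * M)%N, (m * \max_(r < m) (Nr r)).+1%N,
  (fun j => q (j %% m)%N ((j %/ m) %% M)%N \Po x (j %% m)%N); split.
- by rewrite muln_gt0 m0.
- move=> j; have [sq _] := qP (j %% m)%N (ltn_pmod j m0).
  have sx : (size (x (j %% m)%N) <= 2)%N.
    by rewrite (leq_trans (size_scale_leq _ _))// size_XsubC.
  have [->|q0] := eqVneq (q (j %% m)%N (j %/ m %% M)%N) 0.
    by rewrite comp_poly0 size_poly0.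
  rewrite (leq_trans (size_comp_poly_leq _ _))//.
  have := sq (j %/ m %% M)%N; case: (size _) => // k kd /=.
  rewrite ltnS (leq_trans _ (_ : k <= d)%N)//.
  by rewrite -{2}[k]muln1 leq_mul// -subn1 leq_subLR.
- move=> t Nt; have [_ hq] := qP (t %% m)%N (ltn_pmod t m0).
  have -> : ((t %% (m * M)) %% m = t %% m)%N by rewrite modn_dvdm// dvdn_mulr.
  have -> : ((t %% (m * M)) %/ m %% M = (t %/ m) %% M)%N.
    by rewrite [(m * M)%N]mulnC -modn_divl modn_mod.
  have tE : t = (m * (t %/ m) + t %% m)%N by rewrite mulnC -divn_eq.
  rewrite {1}tE hq.
    rewrite horner_comp !hornerE; congr (_.[_]).
    have mn0 : (m%:R : rat) != 0 by rewrite pnatr_eq0 -lt0n.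
    by apply: (mulfI mn0); rewrite mulVKf// {2}tE natrD natrM addrK.
  have : (Nr (t %% m)%N <= \max_(r < m) Nr r)%N.
    exact: (leq_bigmax (Ordinal (ltn_pmod t m0))).
  by rewrite leq_divRL// => H; rewrite (leq_trans _ (ltnW Nt))// mulnC leq_mul2l H orbT.
Qed.

(** * Passage between [evqp] and [EQP] with its degree *)

Lemma nearN (P : nat -> Prop) :
  (\forall t \near eventually, P t) <-> exists N, forall t, (N <= t)%N -> P t.
Proof.
split=> [[N _ PN]|[N PN]]; first by exists N => t /PN.
by exists N => // t /PN.
Qed.

Lemma horner3 (p : {poly rat}) x : (size p <= 3)%N ->
  p.[x] = p`_0 + p`_1 * x + p`_2 * x ^+ 2.
Proof. by move=> sp; rewrite (horner_coef_wide _ sp) !big_ord_recr big_ord0 /=; ring. Qed.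

(* The third difference of a polynomial of degree at most 2 vanishes. *)
Lemma int_valued_backward (p : {poly rat}) M N r : (size p <= 3)%N -> (0 < M)%N ->
  (forall t, (N <= t)%N -> (t %% M)%N = r -> p.[t%:R] \is a Num.int) ->
  forall t, (t %% M)%N = r -> p.[t%:R] \is a Num.int.
Proof.
move=> sp M0 pN t; have [k] := ubnP (N - t)%N; elim: k t => // k IHk t Ntk tr.
have [Nt|tN] := leqP N t; first exact: pN.
have IH i : (0 < i)%N -> p.[(t + i * M)%N%:R] \is a Num.int.
  move=> i0; apply: IHk; last by rewrite addnC modnMDl.
  have : (0 < i * M)%N by rewrite muln_gt0 i0.
  by lia.
have -> : p.[t%:R] = p.[(t + 1 * M)%N%:R] *+ 3 - p.[(t + 2 * M)%N%:R] *+ 3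
    + p.[(t + 3 * M)%N%:R].
  by rewrite !horner3// !natrD; ring.
by rewrite rpredD ?rpredB ?rpredMn ?IH.
Qed.

(** [has_components] requires integer values at every positive [t]. By [int_valued_backward] each
    polynomial is integral on its whole class, so the floor in the witness changes no value. *)
Lemma evqp2_components h : evqp 2 h -> exists (g : nat -> int) (c : seq {poly rat}) N,
  [/\ has_components g c, forall t, (N <= t)%N -> h t = g t &
      forall p, p \in c -> (size p <= 3)%N].
Proof.
move=> [M [N [p [M0 sp hp]]]].
have pint t : (p (t %% M)%N).[t%:R] \is a Num.int.
  apply: (@int_valued_backward _ M N (t %% M)%N) => // u Nu <-.
  by rewrite -hp// intr_int.
exists (fun t => Num.floor (p (t %% M)%N).[t%:R]), (mkseq p M), N; split.
- split=> [|t _]; rewrite size_mkseq// nth_mkseq ?ltn_pmod//.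
  exact/floorK.
- by move=> t Nt; rewrite -hp// intrKfloor.
- by move=> q /mapP[j _ ->].
Qed.

Lemma horner_inj_infinite (p q : {poly rat}) (u : nat -> nat) :
  injective u -> (forall k, p.[(u k)%:R] = q.[(u k)%:R]) -> p = q.
Proof.
move=> uI pq; apply/eqP; rewrite -subr_eq0; apply/negPn/negP => pq0.
pose s := [seq (u k)%:R : rat | k <- iota 0 (size (p - q))].
have : (size s < size (p - q)%R)%N.
  apply: max_poly_roots => //.
    by apply/allP => _ /mapP[k _ ->]; rewrite rootE !hornerE pq subrr.
  rewrite map_inj_uniq ?iota_uniq// => i j /eqP.
  by rewrite eqr_nat => /eqP/uI.
by rewrite size_map size_iota ltnn.
Qed.

(** [EQP_degree] may come from any representation [c']. Each component of [c'] agrees with a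
    component of [c] at infinitely many arguments, hence equals it and inherits its bound. *)
Lemma evqp2_EQP h : evqp 2 h -> EQP h /\ (EQP_degree h <= 2)%N.
Proof.
move=> h2; have [g [c [N [gc hg sc]]]] := evqp2_components h2; split.
  by exists g; [exists c|apply/nearN; exists N].
rewrite /EQP_degree; case: xgetP => // _ -> [g' [c' [[c'0 g'c] /nearN[N' hg'] ->]]].
apply/bigmax_leqP_seq => q qc _.
(* The arguments [u k] exceed both thresholds and have a fixed residue modulo each period, the one
   modulo [size c'] being the index of [q]. *)
have [c0 gE] := gc; pose u k := (index q c' + (k + N + N').+1 * (size c * size c'))%N.
have cc : (0 < size c * size c')%N by rewrite muln_gt0 c0.
have Nu k : (maxn N N' < u k)%N.
  rewrite /u; have : ((k + N + N').+1 * 1 <= (k + N + N').+1 * (size c * size c'))%N.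
    by rewrite leq_mul2l cc orbT.
  by lia.
pose j := (index q c' %% size c)%N; suff -> : q = nth 0 c j.
  suff : (size (nth 0%R c j) <= 3)%N by case: (size _) => [|[|[|[|]]]].
  by apply/sc/mem_nth/ltn_pmod.
apply: (@horner_inj_infinite _ _ u) => [k l|k].
  by move/addnI/eqP; rewrite eqn_mul2r gtn_eqF//= => /eqP; lia.
have -> : j = (u k %% size c)%N.
  by rewrite /j /u [(size c * _)%N]mulnC mulnA addnC modnMDl.
rewrite -gE; last by have := Nu k; lia.
have qE : q = c'`_(u k %% size c')%N.
  by rewrite /u mulnA addnC modnMDl modn_small ?nth_index// index_mem.
by rewrite {1}qE -g'c -?hg -?hg'//; have := Nu k; lia.
Qed.

Lemma EQP_evqp h d : EQP h -> (EQP_degree h <= d)%N -> evqp d h.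
Proof.
move=> [g0 [c0 g0c0] hg0]; rewrite /EQP_degree; case: xgetP; last first.
  (* The default value of [EQP_degree] is excluded: [c0] provides a degree. *)
  by move=> /(_ (\max_(p <- c0) (size p).-1)%N) + _; case; exists g0, c0.
move=> _ -> [g [c [[c1 gc] /nearN[N hg] ->]]] cd.
(* The successor excludes [t = 0], where [has_components] says nothing. *)
exists (size c), N.+1, (nth 0 c); split=> // [j|t Nt].
  have [jc|jc] := ltnP j (size c); last by rewrite nth_default// size_poly0.
  have := leq_trans (@leq_bigmax_seq _ c xpredT (fun p : {poly rat} => (size p).-1) _ (mem_nth 0 jc) isT) cd.
  by case: (size _).
by rewrite hg ?gc//; lia.
Qed.

(** On such a progression [h] is linear over the rationals. The slope is the difference of two
    consecutive values, so it is an integer, and so is the constant term. *)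
Lemma evqp1_progression h : evqp 1 h -> exists M0, (0 < M0)%N /\
  forall M r, (0 < M)%N -> (M0 %| M)%N -> exists (a b : int) N,
  forall s, (N <= s)%N -> h (M * s + r)%N = a * s%:Z + b.
Proof.
move=> [M0 [N [p [M00 sp hp]]]]; exists M0; split=> // M r MP dM.
exists (h (M * N.+1 + r)%N - h (M * N + r)%N).
exists (h (M * N + r)%N - (h (M * N.+1 + r)%N - h (M * N + r)%N) * N%:Z), N => s Ns.
have hE t : (N <= t)%N -> (h (M * t + r)%N)%:~R =
    (p (r %% M0)%N)`_0 + (p (r %% M0)%N)`_1 * (M%:R * t%:R + r%:R).
  move=> Nt; rewrite hp; last by rewrite (leq_trans Nt)// (leq_trans _ (leq_addr _ _))// leq_pmull.
  rewrite -modnDml (eqP (dvdn_mulr t dM)) add0n horner3 ?(leq_trans (sp _))//.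
  by rewrite [_`_2]nth_default ?sp// mul0r addr0 natrD natrM.
apply: (@intr_inj rat); rewrite !(intrD, intrM, mulrNz) !hE//.
by rewrite -!pmulrn -[N.+1]addn1 natrD; ring.
Qed.

(** * Reduced representations and bounds on the Frobenius number *)

(* [pos] selects nonnegative coefficients, so that the span and the semigroup
   are treated at once. *)
Definition represents (pos : bool) n (a : 'I_n -> int) (x : int) : Prop :=
  exists2 p : 'I_n -> int, (pos -> forall i, 0 <= p i) & x = \sum_(i < n) p i * a i.

Lemma in_spanE n (a : 'I_n -> int) x : in_span a x <-> represents false a x.
Proof. by split=> [[p ->]|[p _ ->]]; exists p. Qed.

Lemma in_semigroupE n (a : 'I_n -> int) x : in_semigroup a x <-> represents true a x.
Proof.
split=> [[p ->]|[p /(_ isT) p0 ->]]; first by exists (fun i => (p i)%:Z).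
by exists (fun i => absz (p i)); apply: eq_bigr => i _; rewrite gez0_abs.
Qed.

(* Trading multiples of [a i0] for multiples of the other generators. *)
Lemma represents_reduced pos n (a : 'I_n -> int) i0 x : (forall i, 0 < a i) ->
  represents pos a x -> exists p : 'I_n -> int,
  [/\ x = \sum_(i < n) p i * a i, pos -> 0 <= p i0 &
      forall i, i != i0 -> 0 <= p i < a i0].
Proof.
move=> a0 [p p0 ->].
exists (fun i => if i == i0 then p i0 + \sum_(j < n | j != i0) (p j %/ a i0)%Z * a j
                 else (p i %% a i0)%Z); split.
- rewrite (bigD1 i0)//= [RHS](bigD1 i0)//= eqxx mulrDl -addrA; congr (_ + _).
  rewrite mulr_suml -big_split/=; apply: eq_bigr => i /negPf->.
  by rewrite {1}(divz_eq (p i) (a i0)); ring.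
- move=> /p0 {}p0; rewrite eqxx addr_ge0// sumr_ge0// => i _.
  by rewrite mulr_ge0 ?(ltW (a0 _))// divz_ge0.
- by move=> i /negPf->; rewrite modz_ge0 ?ltz_pmod// lt0r_neq0.
Qed.

(** The terms with [i != i0] add at least 0 and at most [a i0] times the sum of the other
    generators; including [a i0] in that sum makes the bound strict. *)
Lemma represents_bounded pos n (a : 'I_n -> int) i0 x : (forall i, 0 < a i) ->
  represents pos a x -> exists p : 'I_n -> int,
  [/\ x = \sum_(i < n) p i * a i, pos -> 0 <= p i0,
      forall i, i != i0 -> 0 <= p i < a i0 &
      p i0 * a i0 <= x < (p i0 + \sum_(i < n) a i) * a i0].
Proof.
move=> a0 /(represents_reduced i0 a0)[p [xE p00 pi]]; exists p; split=> //.
have R0 : 0 <= \sum_(i < n | i != i0) p i * a i.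
  by apply: sumr_ge0 => i /pi /andP[pi0 _]; rewrite mulr_ge0 ?(ltW (a0 _)).
have R1 : \sum_(i < n | i != i0) p i * a i <= (\sum_(i < n | i != i0) a i) * a i0.
  rewrite mulr_suml; apply: ler_sum => i /pi /andP[_ /ltW pi1].
  by rewrite mulrC ler_wpM2l ?(ltW (a0 _)).
have sq : 0 < a i0 * a i0 by rewrite mulr_gt0.
rewrite xE (bigD1 i0)//= (bigD1 (P := xpredT) (F := a) i0)//=.
by rewrite lerDl R0 !mulrDl ltrD2l (le_lt_trans R1)// ltrDr.
Qed.

(** A reduced representation with [p i0 > 0] lies in the semigroup, so gaps have [p i0 <= 0] and
    stay below [B]. As [- a i0] is itself a gap, there is a largest one, [B - k] with [k]
    minimal. *)
Lemma is_frobenius_exists n (a : 'I_n -> int) i0 : (forall i, 0 < a i) ->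
  exists2 x, is_frobenius a x & - a i0 <= x < (\sum_(i < n) a i) * a i0.
Proof.
move=> a0; pose B := (\sum_(i < n) a i) * a i0.
have gapB x : in_span a x -> ~ in_semigroup a x -> x < B.
  move=> /in_spanE /(represents_bounded i0 a0)[p [xE _ pi /andP[_ xB]]] nx.
  apply: (lt_le_trans xB); rewrite ler_wpM2r ?(ltW (a0 _))// gerDr.
  rewrite leNgt; apply/negP => p0; apply: nx; apply/in_semigroupE.
  exists p => // _ i; have [->|/pi /andP[]//] := eqVneq i i0.
  exact: ltW.
have gap0 : in_span a (- a i0) /\ ~ in_semigroup a (- a i0).
  split.
    exists (fun i => - (i == i0)%:Z); rewrite (bigD1 i0)//= eqxx mulN1r big1 ?addr0//.
    by move=> i /negPf->; rewrite oppr0 mul0r.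
  move=> [p /eqP]; apply/negP; rewrite lt_eqF// (lt_le_trans (_ : _ < 0)) ?oppr_lt0//.
  by rewrite sumr_ge0// => i _; rewrite mulr_ge0 ?(ltW (a0 _)).
have exk : exists k : nat, `[< in_span a (B - k%:Z) /\ ~ in_semigroup a (B - k%:Z) >].
  exists (absz (B + a i0)); apply/asboolP; rewrite gez0_abs ?opprD ?addNKr//.
  by have [gs gn] := gap0; have := gapB _ gs gn; lia.
have := ex_minnP exk => -[k /asboolP[kspan ksemi] kmin].
have xmax y : in_span a y -> ~ in_semigroup a y -> y <= B - k%:Z.
  move=> ys yn; have yB := gapB y ys yn.
  have yE : y = B - (absz (B - y))%:Z by lia.
  have : (k <= absz (B - y))%N by apply/kmin/asboolP; rewrite -yE.
  by lia.
exists (B - k%:Z); first by split.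
by rewrite gapB// andbT; case: gap0 => gs gn; apply: xmax.
Qed.

Lemma frobeniusP n (a : 'I_n -> int) i0 : (forall i, 0 < a i) ->
  is_frobenius a (frobenius a) /\
  - a i0 <= frobenius a < (\sum_(i < n) a i) * a i0.
Proof.
move=> a0; have [x xF xB] := is_frobenius_exists i0 a0.
rewrite /frobenius; case: xgetP => [y _ [ys yn ymax]|/(_ x)//].
case: (xF) => xs xn xmax; suff -> : y = x by [].
by apply/le_anti; rewrite xmax// ymax.
Qed.

(** * Base [s] digits of the Frobenius number as Presburger formulas *)

(** With constant [al] and [be] these equations are linear in [p], whereas [p i * (al i * s + be i)]
    is not a Presburger term. *)
Definition represents2 (pos : bool) n (al be : 'I_n -> int) (u v : int) : Prop :=
  exists p : 'I_n -> int, [/\ pos -> forall i, 0 <= p i,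
    u = \sum_(i < n) p i * al i & v = \sum_(i < n) p i * be i].

Lemma represents2S pos n (al be : 'I_n.+1 -> int) u v :
  represents2 pos al be u v <-> exists x, (pos -> 0 <= x) /\
    represents2 pos (fun i => al (lift ord0 i)) (fun i => be (lift ord0 i))
      (u - al ord0 * x) (v - be ord0 * x).
Proof.
split=> [[p [p0 -> ->]]|[x [x0 [p [p0 uE vE]]]]].
  exists (p ord0); split=> [/p0//|]; exists (fun i => p (lift ord0 i)).
  by split=> [/p0//||]; rewrite big_ord_recl addrC mulrC addKr.
exists (fun i => if unlift ord0 i is Some j then p j else x); split.
- by move=> ps i; case: unliftP => [j _|_]; [exact: p0|exact: x0].
- rewrite big_ord_recl unlift_none; under eq_bigr do rewrite liftK.
  by rewrite -uE; ring.
- rewrite big_ord_recl unlift_none; under eq_bigr do rewrite liftK.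
  by rewrite -vE; ring.
Qed.

Lemma pb_represents2 pos n (al be : 'I_n -> int) V (A : (V -> int) -> Prop) f g :
  affine_class A -> A f -> A g ->
  presburger A (fun v => represents2 pos al be (f v) (g v)).
Proof.
elim: n al be V A f g => [|n IHn] al be V A f g Aaff Af Ag.
  apply: eq_presburger (PbAnd (pb_eq Aaff Af (affC Aaff 0))
                              (pb_eq Aaff Ag (affC Aaff 0))) => v; split.
    by case=> -> ->; exists (fun=> 0); split=> //; rewrite big_ord0.
  by case=> p [_]; rewrite !big_ord0.
have Eaff := extend_affine_class Aaff.
have px : presburger (extend A) (fun w => pos -> 0 <= w.2).
  case: pos {IHn}; last by apply: eq_presburger (pb_True Eaff) => v; split.
  apply: eq_presburger (PbGe0 (extend_snd Aaff)) => v.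
  by split=> [//|]; apply.
have Ef h c : A h -> extend A (fun w => h w.1 - c * w.2).
  by move=> Ah; exists h, (- c); split=> // w; rewrite mulNr.
have pR := IHn (fun i => al (lift ord0 i)) (fun i => be (lift ord0 i)) _ _ _ _ Eaff
  (Ef f (al ord0) Af) (Ef g (be ord0) Ag).
by apply: eq_presburger (pb_exists Aaff (PbAnd px pR)) => v; rewrite represents2S.
Qed.

(** The carry [k - K] runs through the integers from [- K] to [K]; each is a constant, which keeps
    its product with [s] affine. *)
Definition digit_represents (pos : bool) n (al be : 'I_n -> int) (K : nat) s x1 x0 : Prop :=
  exists2 k, k \in iota 0 (K + K).+1 &
    represents2 pos al be (x1 - (k%:Z - K%:Z)) (x0 + (k%:Z - K%:Z) * s).

(** The carry is [x1 - u = (v - x0) / s]. Coefficients bounded by [(2 * B + 1) * s] give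
    [|v| <= B * (2 * B + 1) * s], and [x0 < s] accounts for the final [+ 1] in the bound. *)
Lemma represents_digits pos n (al be : 'I_n -> int) i0 (B : nat) s x1 x0 :
  let a i := al i * s + be i in
  (forall i, 0 < a i) -> \sum_(i < n) a i <= B%:Z * s ->
  \sum_(i < n) `|be i| <= B%:Z -> 0 <= x0 < s -> `|x1| <= B%:Z * a i0 ->
  represents pos a (x1 * s + x0) <->
  digit_represents pos al be (B * (2 * B + 1) + 1) s x1 x0.
Proof.
move=> a a0 aB beB x0s x1B; have s0 : 0 < s by lia.
set K := (B * _ + 1)%N; split; last first.
  case=> k _ [p [p0 uE vE]]; exists p => //.
  under eq_bigr do rewrite /a mulrDr mulrA.
  by rewrite big_split/= -mulr_suml -uE -vE; ring.
move=> /(represents_bounded i0 a0)[p [xE p00 pi /andP[p1 p2]]].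
set S := \sum_(i < n) a i in aB p2.
pose u := \sum_(i < n) p i * al i; pose v := \sum_(i < n) p i * be i.
have uvE : x1 * s + x0 = u * s + v.
  rewrite xE mulr_suml -big_split/=; apply: eq_bigr => i _.
  by rewrite /a; ring.
have ai0B : a i0 <= B%:Z * s.
  apply: le_trans aB; rewrite /S (bigD1 i0)//= lerDl sumr_ge0// => i _.
  exact: ltW.
(* For [i0], [|p i0| * a i0] is at most [|x1 * s| + x0 + S * a i0], and these three terms are at
   most [B], [1] and [B] times [s * a i0]. *)
have pB i : `|p i| <= (2 * B + 1)%N%:Z * s.
  have [->|/pi] := eqVneq i i0; last by nia.
  rewrite -(ler_pM2r (a0 i0)) -[X in _ * X <= _]gtr0_norm// -normrM.
  have e1 : `|x1 * s| <= B%:Z * a i0 * s.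
    by rewrite normrM (gtr0_norm s0) ler_wpM2r// ltW.
  have e2 : S * a i0 <= B%:Z * s * a i0 by rewrite ler_wpM2r// ltW.
  have e3 : s * 1 <= s * a i0 by rewrite ler_wpM2l ?(ltW s0)//; have := a0 i0; lia.
  have e4 : 0 <= B%:Z * s * a i0 by rewrite !mulr_ge0// ltW.
  by clear -e1 e2 e3 e4 p1 p2 x0s; lia.
have vB : `|v| <= (2 * B + 1)%N%:Z * s * B%:Z.
  apply: (le_trans (ler_norm_sum _ _ _)).
  apply: le_trans (_ : \sum_(i < n) (2 * B + 1)%N%:Z * s * `|be i| <= _).
    by apply: ler_sum => i _; rewrite normrM ler_wpM2r.
  by rewrite -mulr_sumr ler_wpM2l// mulr_ge0// ltW.
have kK : `|x1 - u| <= K%:Z.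
  rewrite -(ler_pM2r s0) -[X in _ * X <= _]gtr0_norm// -normrM.
  have -> : (x1 - u) * s = v - x0 by lia.
  rewrite (le_trans (ler_normB _ _))// (ger0_norm (_ : 0 <= x0)); last by lia.
  rewrite /K PoszD PoszM mulrDl mul1r lerD//; last by lia.
  by rewrite (le_trans vB)// mulrAC [X in X * s]mulrC.
exists (absz (x1 - u + K%:Z)); first by rewrite mem_iota; lia.
have -> : (absz (x1 - u + K%:Z))%:Z - K%:Z = x1 - u by lia.
exists p; split; [|by rewrite subKr|by rewrite -/v; lia].
move=> ps i; have [->|/pi /andP[]//] := eqVneq i i0.
exact: p00.
Qed.

(** The range of [x1] is the one in which [represents_digits] applies; it contains the quotient of
    the Frobenius number. *)
Definition digit_gap n (al be : 'I_n -> int) i0 (B : nat) s x1 x0 : Prop :=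
  [/\ 0 <= x0 < s, `|x1| <= B%:Z * (al i0 * s + be i0),
      digit_represents false al be (B * (2 * B + 1) + 1) s x1 x0 &
      ~ digit_represents true al be (B * (2 * B + 1) + 1) s x1 x0].

Lemma pb_digit_gap n (al be : 'I_n -> int) i0 B V (A : (V -> int) -> Prop) s x1 x0 :
  affine_class A -> A s -> A x1 -> A x0 ->
  presburger A (fun v => digit_gap al be i0 B (s v) (x1 v) (x0 v)).
Proof.
move=> Aaff As A1 A0.
have pR pos K : presburger A
    (fun v => digit_represents pos al be K (s v) (x1 v) (x0 v)).
  apply: (pb_bex Aaff) => k; apply: (pb_represents2 _ _ _ Aaff).
    exact: (affD Aaff A1 (affC Aaff (- (k%:Z - K%:Z)))).
  exact: (affD Aaff A0 (affM Aaff _ As)).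
have Aa : A (fun v => B%:Z * (al i0 * s v + be i0)).
  exact: (affM Aaff _ (affD Aaff (affM Aaff _ As) (affC Aaff _))).
have p1 := PbAnd (pb_le Aaff (affC Aaff 0) A0) (pb_lt Aaff A0 As).
have p2 := PbAnd (pb_le Aaff (affM Aaff (-1) A1) Aa) (pb_le Aaff A1 Aa).
pose K := (B * (2 * B + 1) + 1)%N.
apply: eq_presburger (PbAnd (PbAnd p1 p2)
  (PbAnd (pR false K) (PbNot (pR true K)))) => v; split.
  by case=> [[[h1 h2] [h3 h4]] [h5 h6]]; split=> //; lia.
by case=> h1 h2 h3 h4; split; split=> //; lia.
Qed.

(** As low digits lie between 0 and [s - 1], integers compare as their digits do lexicographically,
    without the product [x1 * s]. *)
Definition digit_frobenius n (al be : 'I_n -> int) i0 (B : nat) s x1 x0 : Prop :=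
  digit_gap al be i0 B s x1 x0 /\ forall y1 y0, digit_gap al be i0 B s y1 y0 ->
    y1 < x1 \/ (y1 = x1 /\ y0 <= x0).

Lemma pb_digit_frobenius n (al be : 'I_n -> int) i0 B V (A : (V -> int) -> Prop) s x1 x0 :
  affine_class A -> A s -> A x1 -> A x0 ->
  presburger A (fun v => digit_frobenius al be i0 B (s v) (x1 v) (x0 v)).
Proof.
move=> Aaff As A1 A0; apply: PbAnd; first exact: pb_digit_gap.
have Aaff1 := extend_affine_class Aaff; have Aaff2 := extend_affine_class Aaff1.
have E f (Af : A f) := extend_fst (extend_fst Af).
have Ey1 := extend_fst (extend_snd Aaff); have Ey0 := extend_snd Aaff1.
have pG := pb_digit_gap al be i0 B Aaff2 (E _ As) Ey1 Ey0.
have pL := pb_or (pb_lt Aaff2 Ey1 (E _ A1))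
  (PbAnd (pb_eq Aaff2 Ey1 (E _ A1)) (pb_le Aaff2 Ey0 (E _ A0))).
exact: (pb_forall Aaff (pb_forall Aaff1 (pb_imp pG pL))).
Qed.

Lemma digit_frobeniusP n (al be : 'I_n -> int) i0 (B : nat) s x1 x0 :
  let a i := al i * s + be i in
  (forall i, 0 < a i) -> 1 <= s -> \sum_(i < n) a i <= B%:Z * s ->
  \sum_(i < n) `|be i| <= B%:Z ->
  digit_frobenius al be i0 B s x1 x0 <->
    x1 = (frobenius a %/ s)%Z /\ x0 = (frobenius a %% s)%Z.
Proof.
move=> a a0 s1 aB beB.
have gapE y1 y0 : digit_gap al be i0 B s y1 y0 <->
    [/\ 0 <= y0 < s, `|y1| <= B%:Z * a i0, in_span a (y1 * s + y0) &
        ~ in_semigroup a (y1 * s + y0)].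
  split=> -[h1 h2 h3 h4]; split=> //.
  - by apply/in_spanE/(represents_digits _ a0 aB beB h1 h2).
  - by move=> /in_semigroupE/(represents_digits _ a0 aB beB h1 h2).
  - by apply/(represents_digits _ a0 aB beB h1 h2)/in_spanE.
  - by move=> /(represents_digits _ a0 aB beB h1 h2)/in_semigroupE.
have [[Fspan Fsemi Fmax] /andP[F1 F2]] := frobeniusP i0 a0.
set F := frobenius a in Fspan Fsemi Fmax F1 F2 *.
have FE := divz_eq F s; set q := (F %/ s)%Z in FE *; set r := (F %% s)%Z in FE *.
have r0s : 0 <= r < s by rewrite modz_ge0 ?ltz_pmod//; lia.
have a00 := a0 i0.
have FG : digit_gap al be i0 B s q r.
  apply/gapE; split; rewrite -?FE//.
  have SB : (\sum_(i < n) a i) * a i0 <= B%:Z * s * a i0 by rewrite ler_wpM2r// ltW.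
  (* This turns the lower bound [- a i0] on [q] into [- B * a i0]. *)
  have B0 : 1 <= B%:Z.
    have : 0 < \sum_(i < n) a i.
      by rewrite (bigD1 i0)//= ltr_wpDr// sumr_ge0// => i _; exact: ltW.
    by move=> /lt_le_trans /(_ aB); clear -s1; nia.
  have q1 : q < B%:Z * a i0.
    have s0 : 0 < s by lia.
    rewrite -(ltr_pM2r s0) mulrAC (lt_le_trans (le_lt_trans _ F2) SB)//.
    by clear -FE r0s; lia.
  have q2 : - a i0 - 1 < q.
    have s0 : 0 < s by lia.
    rewrite -(ltr_pM2r s0).
    have : a i0 * 1 <= a i0 * s by rewrite ler_wpM2l// ltW.
    by clear -FE r0s F1; lia.
  have : a i0 * 1 <= a i0 * B%:Z by rewrite ler_wpM2l// ltW.
  by clear -q1 q2; lia.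
split=> [[/gapE[x0s x1B xspan xsemi] /(_ _ _ FG) qx]|[-> ->]].
  have := Fmax _ xspan xsemi; rewrite FE => xF.
  have : x1 <= q by clear -xF r0s x0s; nia.
  by case: qx => [|[qx]]; [lia|move: xF; rewrite qx; lia].
split=> // y1 y0 /gapE[y0s y1B yspan ysemi].
have := Fmax _ yspan ysemi; rewrite FE => yF.
have : y1 <= q by clear -yF r0s y0s; nia.
rewrite le_eqVlt => /orP[/eqP yq|]; [right|by left].
by split=> //; move: yF; rewrite yq; lia.
Qed.

(** * Linear generators, and reduction of the general case to them *)

Lemma evqp_frobenius_linear n (al be : 'I_n -> int) (i0 : 'I_n) S0 :
  (forall i (t : nat), (S0 <= t)%N -> 0 < al i * t%:Z + be i) ->
  evqp 2 (fun t => frobenius (fun i => al i * t%:Z + be i)).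
Proof.
(* For [s >= 1] this constant serves both bounds required by [digit_frobeniusP]; [S0.+1] below
   ensures [s >= 1]. *)
move=> a0; pose B := (\sum_(i < n) (absz (al i) + absz (be i)))%N.
have BE : B%:Z = \sum_(i < n) (absz (al i) + absz (be i))%N%:Z.
  exact: (big_morph Posz PoszD).
pose F (s : int) := frobenius (fun i => al i * s + be i).
have FP s x1 x0 : S0.+1%:Z <= s -> digit_frobenius al be i0 B s x1 x0 <->
    x1 = (F s %/ s)%Z /\ x0 = (F s %% s)%Z.
  move=> Ss; have sE : s = (absz s)%:Z by lia.
  apply: digit_frobeniusP; [|lia| |].
  - by move=> i; rewrite sE; apply: a0; lia.
  - rewrite BE mulr_suml; apply: ler_sum => i _.
    rewrite PoszD mulrDl lerD// ?ler_wpM2r//; [lia|lia|].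
    have : (absz (be i))%:Z * 1 <= (absz (be i))%:Z * s by rewrite ler_wpM2l//; lia.
    by lia.
  - rewrite BE; apply: ler_sum => i _; lia.
have Aaff := affine1_class; have Aaff1 := extend_affine_class Aaff.
have Es : affine1 id by exists 1, 0 => s; rewrite mul1r addr0.
have Es2 := extend_fst (extend_fst Es).
have E1 := extend_fst (extend_snd Aaff); have E0 := extend_snd Aaff1.
have Aaff2 := extend_affine_class Aaff1.
have e1 : evqp 1 (fun t : nat => (F t %/ t)%Z).
  pose g (s : int) := (F s %/ s)%Z.
  apply: (@presburger_fun_evqp _ g S0.+1
    (pb_exists Aaff1 (pb_digit_frobenius al be i0 B Aaff2 Es2 E1 E0))) => s y Ss /=.
  split=> [[x0 /(FP _ _ _ Ss)[]//]|->].
  by exists (F s %% s)%Z; apply/FP.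
(* The two digit variables are exchanged, so that the high digit is now the one projected out. *)
have e0 : evqp 1 (fun t : nat => (F t %% t)%Z).
  pose g (s : int) := (F s %% s)%Z.
  apply: (@presburger_fun_evqp _ g S0.+1
    (pb_exists Aaff1 (pb_digit_frobenius al be i0 B Aaff2 Es2 E0 E1))) => s y Ss /=.
  split=> [[x1 /(FP _ _ _ Ss)[]//]|->].
  by exists (F s %/ s)%Z; apply/FP.
apply: (evqp_combine (op := fun p q => p * 'X + q) _ _ e1 e0) => [p q sp sq|t p q pE qE].
  rewrite (leq_trans (size_polyD _ _))// geq_max (leq_trans (size_mul_leq _ _)) ?size_polyX.
    exact: leq_trans sq _.
  by rewrite addn2.
by rewrite -/(F t) (divz_eq (F t) t) hornerD hornerMX intrD intrM pE qE.
Qed.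

Theorem theorem1 (n : nat) (n_ge1 : (1 <= n)%N) (a : 'I_n -> nat -> int)
    (a_EQP : forall i, EQP (a i))
    (a_pos : forall i, \forall t \near eventually, 0 < a i t)
    (a_deg : forall i, (EQP_degree (a i) <= 1)%N) :
  [/\ \forall t \near eventually,
        is_frobenius (fun i => a i t) (frobenius (fun i => a i t)),
      EQP (fun t => frobenius (fun i => a i t))
    & (EQP_degree (fun t => frobenius (fun i => a i t)) <= 2)%N].
Proof.
pose i0 := Ordinal n_ge1.
have /choice[N aN] i : exists N, forall t, (N <= t)%N -> 0 < a i t by apply/nearN.
pose N0 := (\max_(i < n) N i)%N.
have a0 t i : (N0 <= t)%N -> 0 < a i t.
  by move=> Nt; apply/aN/(leq_trans _ Nt)/leq_bigmax.
have /choice[Ma MaP] i := evqp1_progression (EQP_evqp (a_EQP i) (a_deg i)).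
(* Modulo this common multiple of the periods, every [a i] is eventually linear with integer
   coefficients on each class. *)
pose M := (\prod_(i < n) Ma i)%N.
have M0 : (0 < M)%N by apply: prodn_gt0 => i; case: (MaP i).
suff /evqp2_EQP[FE Fd] : evqp 2 (fun t => frobenius (fun i => a i t)).
  split=> //; apply/nearN; exists N0 => t Nt.
  by case: (frobeniusP i0 (fun i => a0 t i Nt)).
apply: (evqp_glue M0) => r.
have dM i : (Ma i %| M)%N by rewrite /M (bigD1 i)//= dvdn_mulr.
have [al /choice[be /choice[N1 lin]]] := choice (fun i => (MaP i).2 M r M0 (dM i)).
pose N2 := maxn N0 (\max_(i < n) N1 i).
have aE t i : (N2 <= t)%N -> a i (M * t + r)%N = al i * t%:Z + be i.
  move=> Nt; apply/lin/(leq_trans _ Nt)/(leq_trans _ (leq_maxr _ _)).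
  exact: leq_bigmax.
apply: (@eq_evqp _ (fun t : nat => frobenius (fun i => al i * t%:Z + be i)) _ N2).
  by move=> t Nt; congr frobenius; apply/funext => i; rewrite aE.
apply: (evqp_frobenius_linear i0 (S0 := N2)) => i t Nt.
by rewrite -aE//; apply: a0; have := leq_pmull t M0; lia.
Qed.
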